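(* Let $F\colon\mathbb{R}^m\to\mathbb{R}$ be an averaging operator and let $f\in L^\infty(\mathbb{T}_m,\mathbb{R})$. Then there exists a unique solution $u\in L^{\infty}_{loc}([0,+\infty);L^\infty(\mathbb{T}_m,\mathbb{R}))$ of the Cauchy problem $$\begin{cases} u_t(x,t)-\Delta_F u(x,t)=0 & \text{in } \mathbb{T}_m\times(0,+\infty),\\ u(x,0)=f(x) & \text{in } \mathbb{T}_m.\end{cases}$$
   Context: Let $m\in\mathbb{N}$, $m>2$. $\mathbb{T}_m$ is the directed tree with regular $m$-branching: its vertices are the empty sequence $\emptyset$ and all finite sequences $(a_1,\dots,a_k)$, $k\in\mathbb{N}$, with $a_i\in\{0,1,\dots,m-1\}$. Each vertex $x$ has $m$ successors $(x,0),\dots,(x,m-1)$, obtained by appending one more coordinate to $x$. $L^\infty(\mathbb{T}_m,\mathbb{R})$ is the set of bounded functions $f\colon\mathbb{T}_m\to\mathbb{R}$. An averaging operator is a continuous function $F\colon\mathbb{R}^m\to\mathbb{R}$ such that: (i) $F(0,\dots,0)=0$ and $F(1,\dots,1)=1$; (ii) $F(tx_1,\dots,tx_m)=tF(x_1,\dots,x_m)$ for all $t\in\mathbb{R}$; (iii) $F(t+x_1,\dots,t+x_m)=t+F(x_1,\dots,x_m)$ for all $t\in\mathbb{R}$; (iv) $F(x_1,\dots,x_m)<\max\{x_1,\dots,x_m\}$ if not all $x_j$ are equal; (v) $F$ is nondecreasing with respect to each variable. $\Delta_F u(x,t)=F(u((x,0),t),\dots,u((x,m-1),t))-u(x,t)$.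 $L^{\infty}_{loc}([0,+\infty);L^\infty(\mathbb{T}_m,\mathbb{R}))$ is the set of functions $v$ on $\mathbb{T}_m\times[0,+\infty)$ (measurable in $t$) that are bounded on $\mathbb{T}_m\times[0,T]$ for every $T>0$. A solution of the Cauchy problem is a function $u$ such that, for each vertex $x$, $u(x,\cdot)$ is continuous on $[0,+\infty)$, differentiable on $(0,+\infty)$, satisfies the equation at every $t>0$, and $u(x,0)=f(x)$. *)

(* Defs.v *)
From HB Require Import structures.
From mathcomp Require Import all_boot all_order all_algebra.
From mathcomp Require Import all_classical all_reals all_analysis.
Import Order.TTheory GRing.Theory Num.Theory.
Import numFieldNormedType.Exports.

Set Implicit Arguments.
Unset Strict Implicit.
Unset Printing Implicit Defensive.

Local Open Scope classical_set_scope.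
Local Open Scope ring_scope.

(* A vertex is the finite sequence of its coordinates, [::] being the root. *)
Definition tree (m : nat) : Type := seq 'I_m.

Definition successor (m : nat) (x : tree m) (i : 'I_m) : tree m := rcons x i.

(* In [avg_lt_max] the seed [x 0 i] of the iterated maximum is one of the
   coordinates, so that the value is exactly the maximum of the coordinates. *)
Record averaging_operator (R : realType) (m : nat) (F : 'rV[R]_m -> R) : Prop :=
  AveragingOperator {
    avg_continuous : continuous F;
    avg_zero : F (const_mx 0) = 0;
    avg_one : F (const_mx 1) = 1;
    avg_homogeneous : forall (t : R) (x : 'rV[R]_m), F (t *: x) = t * F x;
    avg_translation :
      forall (t : R) (x : 'rV[R]_m), F (const_mx t + x) = t + F x;
    avg_lt_max : forall (x : 'rV[R]_m) (i j : 'I_m), x 0 i != x 0 j ->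
      F x < \big[Num.max/x 0 i]_(k < m) x 0 k;
    avg_nondecreasing : forall (x y : 'rV[R]_m) (j : 'I_m),
      (forall k : 'I_m, k != j -> x 0 k = y 0 k) -> x 0 j <= y 0 j ->
      F x <= F y
  }.

Definition Linfty_tree (R : realType) (m : nat) (f : tree m -> R) : Prop :=
  [bounded f x | x in [set: tree m]].

(* Functions on [0, +oo[ are represented by functions on R of which only the
   values at nonnegative times matter. *)
Definition Linfty_loc (R : realType) (m : nat) (u : tree m -> R -> R) : Prop :=
  (forall x : tree m, measurable_fun (`[0, +oo[ : set R) (u x)) /\
  (forall T : R, 0 < T ->
    [bounded u p.1 p.2 | p in [set: tree m] `*` `[0, T]]).

Definition Delta (R : realType) (m : nat) (F : 'rV[R]_m -> R)
    (u : tree m -> R -> R) (x : tree m) (t : R) : R :=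
  F (\row_(i < m) u (successor x i) t) - u x t.

Definition cauchy_solution (R : realType) (m : nat) (F : 'rV[R]_m -> R)
    (f : tree m -> R) (u : tree m -> R -> R) : Prop :=
  forall x : tree m,
    [/\ {within `[0, +oo[, continuous (u x)},
        forall t : R, 0 < t -> derivable (u x) t 1,
        forall t : R, 0 < t -> derive1 (u x) t - Delta F u x t = 0 &
        u x 0 = f x].

(* Main.v *)
Require Import Defs.
From mathcomp Require Import all_boot all_order all_algebra.
From mathcomp Require Import all_classical all_reals all_analysis.
From mathcomp Require Import measurable_realfun.
From mathcomp Require Import lra ring.
Import Order.TTheory GRing.Theory Num.Theory.
Import numFieldNormedType.Exports.
Set Implicit Arguments.
Unset Strict Implicit.
Unset Printing Implicit Defensive.
Local Open Scope classical_set_scope.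
Local Open Scope ring_scope.

(** The Cauchy problem is a system of ordinary differential equations indexed
    by the vertices, and it is solved by Picard iteration in the sup norm over
    the tree.

    Monotonicity and translation invariance make an averaging operator
    nonexpansive for the sup norm [averaging_lipschitz], so the right-hand side
    Delta_F is 2-Lipschitz in u, uniformly in the vertex [Delta_lipschitz]. One
    Picard step replaces u by the function U with U(x,0) = f(x) and
    U_t = Delta_F u. If two inputs differ by at most K exp(4t), the outputs have
    derivatives differing by at most 2K exp(4t); comparison with the primitive
    of that bound shows that the outputs differ by at most (K/2) exp(4t)
    [picard_step_contraction]. The Picard map is thus a contraction of ratio 1/2
    for the norm weighted by exp(-4t), globally in time.

    Solutions are the fixed points of the Picard map. Two locally bounded ones
    differ by some K on [0, T], hence by at most K exp(4t) / 2^n for every n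
    [picard_fixed_point_unique]. For existence, the Picard iterates starting
    from f, which exist because continuous functions have primitives, move by
    geometrically decreasing amounts and converge locally uniformly. Their limit
    is continuous, so that the Picard step applies to it, and by the contraction
    it is a fixed point at nonnegative times [picard_fixed_point_exists]. *)

(** * Averaging operators are nonexpansive *)

(** The axiom gives monotonicity in one coordinate, so the coordinates of [x]
    are replaced by those of [y] one at a time. *)
Lemma averaging_monotone (R : realType) (m : nat) (F : 'rV[R]_m -> R) :
  averaging_operator F -> forall x y : 'rV[R]_m,
  (forall k, x 0 k <= y 0 k) -> F x <= F y.
Proof.
move=> hF x y xy.
pose z n : 'rV[R]_m := \row_k (if (k < n)%N then y 0 k else x 0 k).
have Fz n : F x <= F (z n).
  elim: n => [|n IHn]; first by rewrite (_ : z 0%N = x)//; apply/rowP => k; rewrite mxE.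
  apply: (le_trans IHn); case: (ltnP n m) => [nm|mn]; last first.
    rewrite (_ : z n.+1 = z n)//; apply/rowP => k; rewrite !mxE.
    by rewrite (leq_trans (ltn_ord k) mn) leqW // (leq_trans (ltn_ord k) mn).
  apply: (avg_nondecreasing hF (j := Ordinal nm)) => [k kn|].
    by rewrite !mxE ltnS [(k <= n)%N]leq_eqVlt (negbTE (kn : (k : nat) != n)).
  by rewrite !mxE /= ltnn ltnSn.
by rewrite [y](_ : y = z m)//; apply/rowP => k; rewrite mxE ltn_ord.
Qed.

(** If the coordinates of [x] and [y] differ by at most [e], then [x] lies below
    [const_mx e + y], and [F] of the latter is [e + F y]. *)
Lemma averaging_lipschitz (R : realType) (m : nat) (F : 'rV[R]_m -> R) :
  averaging_operator F -> forall (x y : 'rV[R]_m) (e : R),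
  (forall k, `|x 0 k - y 0 k| <= e) -> `|F x - F y| <= e.
Proof.
move=> hF.
suff half (x y : 'rV[R]_m) e : (forall k, `|x 0 k - y 0 k| <= e) -> F x <= e + F y.
  move=> x y e xy; have xle := half x y e xy.
  have yle : F y <= e + F x by apply: half => k; rewrite distrC.
  rewrite ler_distl; apply/andP; split; lra.
move=> xy; rewrite -(avg_translation hF); apply: averaging_monotone => // k.
by rewrite !mxE; have := xy k; rewrite ler_distl => /andP[_]; rewrite addrC.
Qed.

(** * Exponentially weighted mean value inequality *)

(** The derivative of [K / 2 * expR (4 * s)] is [2 * (K * expR (4 * s))], so
    this function minus [h] is nondecreasing, and it is [K / 2] at time 0. *)
Lemma le_expR_derive (R : realType) (h dh : R -> R) (K T : R) :
  0 <= K -> {within `[0, T], continuous h} -> h 0 = 0 ->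
  (forall s : R, 0 < s < T -> is_derive s 1 h (dh s)) ->
  (forall s : R, 0 < s < T -> dh s <= 2 * (K * expR (4 * s))) ->
  forall t : R, 0 <= t <= T -> h t <= K / 2 * expR (4 * t).
Proof.
move=> K0 hc h0 hd dhle t /andP[t0 tT].
pose c : R -> R := fun s => K / 2 * expR (4 * s).
have cd (s : R) : is_derive s 1 c (2 * (K * expR (4 * s))).
  have d4 : is_derive s 1 ( *%R (4 : R)) 4.
    by apply: is_derive_eq; rewrite /GRing.scale/= mulr1.
  have -> : 2 * (K * expR (4 * s)) = K / 2 *: (expR (4 * s) * 4).
    by rewrite /GRing.scale/=; lra.
  exact: (is_deriveZ (K / 2) (is_derive1_comp (is_derive_expR (4 * s)) d4)).
have gd (s : R) : 0 < s < T -> is_derive s 1 (c - h) (2 * (K * expR (4 * s)) - dh s).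
  by move=> sT; apply: is_deriveB => //; exact: hd.
have gc : {within `[0, T], continuous (c - h)}.
  move=> s; apply: (@continuousB _ _ (subspace `[0, T]) c h) => //; last exact: hc.
  apply: continuous_subspaceT => {}s.
  by apply/differentiable_continuous/derivable1_diffP; apply: ex_derive.
have := @ger0_derive1_ndecr R (c - h) 0 T _ _ gc 0 t (lexx _) t0 tT.
rewrite /c !fctE h0 subr0 mulr0 expR0 => H.
have : K / 2 * 1 <= K / 2 * expR (4 * t) - h t.
  apply: H => s; rewrite in_itv/= => sT.
    have gds := gd s sT; exact: (@ex_derive _ _ _ _ _ _ _ gds).
  have gds := gd s sT.
  by rewrite derive1E derive_val subr_ge0 dhle.
by lra.
Qed.

Lemma normr_le_expR_derive (R : realType) (h dh : R -> R) (K T : R) :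
  0 <= K -> {within `[0, T], continuous h} -> h 0 = 0 ->
  (forall s : R, 0 < s < T -> is_derive s 1 h (dh s)) ->
  (forall s : R, 0 < s < T -> `|dh s| <= 2 * (K * expR (4 * s))) ->
  forall t : R, 0 <= t <= T -> `|h t| <= K / 2 * expR (4 * t).
Proof.
move=> K0 hc h0 hd dhle t tT; rewrite ler_norml; apply/andP; split.
  rewrite lerNl; apply: (@le_expR_derive R (- h) (- dh) K T) => //.
  - by move=> s; apply: (@continuousN _ _ (subspace `[0, T]) h); exact: hc.
  - by rewrite fctE h0 oppr0.
  - by move=> s sT; apply: is_deriveN; exact: hd.
  - by move=> s /dhle; rewrite fctE ler_norml => /andP[]; lra.
apply: (@le_expR_derive R h dh K T) => // s /dhle.
by rewrite ler_norml => /andP[].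
Qed.

(** * Primitives on the half-line *)

(** The primitive is frozen at negative times, so that it is continuous on the
    whole line and can serve again as input of a Picard step. *)
Lemma halfline_primitive (R : realType) (g : R -> R) : continuous g ->
  exists G : R -> R, [/\ continuous G,
    forall t : R, 0 < t -> is_derive t 1 G (g t) & G 0 = 0].
Proof.
move=> gc.
(* The integral starts at -1 rather than 0, so that the fundamental theorem of
   calculus applies at every nonnegative time, 0 included. *)
pose P t : R := (\int[lebesgue_measure]_(s in `[-1, t]) g s)%R.
have Pd (t : R) : -1 < t -> is_derive t 1 P (g t).
  move=> t1; have tt : t < t + 1 by rewrite ltrDl.
  have gi : lebesgue_measure.-integrable `[-1, t + 1] (EFin \o g).
    apply: continuous_compact_integrable; first exact: segment_compact.
    exact: continuous_subspaceT.
  have [//|Pdt Pt] := @continuous_FTC1 R g (BLeft (-1)) t (t + 1) tt gi _ (gc t).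
  by apply: DeriveDef; [exact: Pdt|rewrite -derive1E; exact: Pt].
pose G t : R := P (Num.max t 0) - P 0.
exists G; split.
- move=> t; apply: cvgB; last exact: cvg_cst.
  have max0 : {for t, continuous (fun s : R => Num.max s 0)}.
    by apply: (@continuous_max R R id (cst 0)); [exact: cvg_id|exact: cvg_cst].
  apply: (continuous_comp max0).
  have Pm : is_derive (Num.max t 0) 1 P (g (Num.max t 0)).
    by apply: Pd; rewrite lt_max; apply/orP; right; lra.
  apply/differentiable_continuous/derivable1_diffP.
  exact: (@ex_derive _ _ _ _ _ _ _ Pm).
- move=> t t0; apply: (@near_eq_is_derive _ _ _ (P - cst (P 0))).
    near=> s; rewrite /G max_l//; apply: ltW; near: s; exact: lt_nbhsr.
  rewrite -[g t]subr0; apply: is_deriveB; apply: Pd; lra.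
- by rewrite /G max_r// subrr.
Unshelve. all: by end_near. Qed.

(** * Sequences with geometrically decreasing increments *)

Lemma le0_halvings (R : realType) (a C : R) :
  (forall n, a <= C / 2 ^+ n) -> a <= 0.
Proof.
move=> aC; rewrite leNgt; apply/negP => a0.
have C0 : 0 < C by have := aC 0%N; rewrite expr0 divr1; exact: lt_le_trans.
pose n := (Num.trunc (C / a)).+1.
have Cn : C / a < n%:R by exact: truncnS_gt.
have n2 : n%:R < 2 ^+ n :> R by rewrite -natrX ltr_nat ltn_expl.
have := aC n; rewrite ler_pdivlMr ?exprn_gt0// leNgt => /negP; apply.
by rewrite -ltr_pdivrMl// mulrC (lt_trans Cn n2).
Qed.

(** The terms [e n] bound the sum of all increments from rank [n] on: the
    intervals of center [a n] and radius [e n] are nested, and the limit is the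
    supremum of their left endpoints. *)
Lemma halving_sequence_limit (R : realType) (a : nat -> R) (C : R) :
  (forall n, `|a n.+1 - a n| <= C / 2 ^+ n) ->
  exists l, forall n, `|a n - l| <= 2 * C / 2 ^+ n.
Proof.
move=> da.
pose e n := 2 * C / 2 ^+ n.
have eS n : e n.+1 = C / 2 ^+ n.
  by rewrite /e exprS; field; rewrite expf_neq0.
have eD n : e n = C / 2 ^+ n + C / 2 ^+ n by rewrite /e; lra.
have lo_mono : {homo (fun n => a n - e n) : p q / (p <= q)%N >-> p <= q}.
  apply: homo_leq => [x//|y x z|n]; first exact: le_trans.
  by have := da n; rewrite eS eD ler_distl => /andP[]; lra.
have hi_mono : {homo (fun n => a n + e n) : p q / (p <= q)%N >-> q <= p}.
  apply: homo_leq => [x//|y x z yx zy|n]; first exact: le_trans zy yx.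
  by have := da n; rewrite eS eD ler_distl => /andP[]; lra.
have e0 n : 0 <= e n.
  by have := le_trans (normr_ge0 _) (da n); rewrite eD; lra.
have lohi p q : a p - e p <= a q + e q.
  have := lo_mono _ _ (leq_maxl p q); have := hi_mono _ _ (leq_maxr p q).
  by have := e0 (maxn p q); lra.
exists (sup (range (fun n => a n - e n))) => n.
rewrite distrC ler_distl; apply/andP; split.
  have ub : has_ubound (range (fun n => a n - e n)).
    by exists (a 0%N + e 0%N) => _ [p _ <-].
  by apply: (ub_le_sup ub); exists n.
have ne : range (fun n => a n - e n) !=set0 by exists (a 0%N - e 0%N), 0%N.
by apply: (ge_sup ne) => _ [p _ <-].
Qed.

(** The bound is uniform on every half-line ]-oo, t + 1], which is what makes the
    convergence locally uniform. *)
Lemma locally_uniform_halving_limit_continuous (R : realType)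
    (a : nat -> R -> R) (l : R -> R) (C : R -> R) :
  {homo C : s t / s <= t} -> (forall n, continuous (a n)) ->
  (forall n t, `|a n t - l t| <= C t / 2 ^+ n) -> continuous l.
Proof.
move=> C_mono ac al t; apply/cvgrPdist_le => e e0.
have [n Cn] : exists n, C (t + 1) / 2 ^+ n <= e / 3.
  apply: contrapT => /forallNP noN.
  suff : e / 3 <= 0 by lra.
  by apply: le0_halvings => n; apply: ltW; rewrite ltNge; apply/negP/noN.
have tail s : s <= t + 1 -> `|a n s - l s| <= e / 3.
  move=> st; apply: le_trans (al n s) _; apply: le_trans Cn.
  by rewrite ler_wpM2r ?invr_ge0 ?exprn_ge0// C_mono.
near=> s.
have at_s : `|a n t - a n s| <= e / 3.
  by near: s; have /cvgrPdist_le := ac n t; apply; rewrite divr_gt0.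
have ls : `|a n s - l s| <= e / 3.
  by apply/tail/ltW; near: s; apply: lt_nbhsl; rewrite ltrDl.
have lt : `|a n t - l t| <= e / 3 by apply: tail; rewrite lerDl.
rewrite ler_distl; move: at_s ls lt; rewrite !ler_distl.
move=> /andP[? ?] /andP[? ?] /andP[? ?]; apply/andP; split; lra.
Unshelve. all: by end_near. Qed.

(** * The Picard map *)

(** A relation rather than a function: for discontinuous [u] there may be no
    such [U], and the values of [U] at negative times are left free. *)
Definition picard_step (R : realType) (m : nat) (F : 'rV[R]_m -> R)
    (f : tree m -> R) (u U : tree m -> R -> R) : Prop :=
  forall x : tree m,
    [/\ {within `[0, +oo[, continuous (U x)},
        forall t : R, 0 < t -> is_derive t 1 (U x) (Delta F u x t) &
        U x 0 = f x].

Lemma cauchy_solution_picard (R : realType) (m : nat) (F : 'rV[R]_m -> R)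
    (f : tree m -> R) (u : tree m -> R -> R) :
  cauchy_solution F f u <-> picard_step F f u u.
Proof.
split=> h x; have [uc] := h x.
  move=> ud ueq u0; split=> // t t0; apply: DeriveDef; first exact: ud.
  by rewrite -derive1E; apply/eqP; rewrite -subr_eq0; apply/eqP; exact: ueq.
move=> ud u0; split=> // t t0; have dt := ud t t0.
  exact: (@ex_derive _ _ _ _ _ _ _ dt).
by rewrite derive1E (@derive_val _ _ _ _ _ _ _ dt) subrr.
Qed.

Section Picard.
Variables (R : realType) (m : nat) (F : 'rV[R]_m -> R).
Hypothesis hF : averaging_operator F.
Implicit Types (f : tree m -> R) (u w U W : tree m -> R -> R).

Lemma Delta_lipschitz u w (t e : R) :
  (forall x, `|u x t - w x t| <= e) ->
  forall x, `|Delta F u x t - Delta F w x t| <= 2 * e.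
Proof.
move=> uw x.
have Fuw : `|F (\row_(i < m) u (successor x i) t) -
             F (\row_(i < m) w (successor x i) t)| <= e.
  by apply: averaging_lipschitz => // k; rewrite !mxE.
have := uw x; move: Fuw; rewrite /Delta !ler_distl => /andP[? ?] /andP[? ?].
apply/andP; split; lra.
Qed.

(** The coordinates are finitely many, so near a time they are simultaneously
    close to their limits, and nonexpansiveness of [F] concludes. *)
Lemma Delta_continuous u : (forall x, continuous (u x)) ->
  forall x, continuous (Delta F u x).
Proof.
move=> uc x t; apply: cvgB; last exact: uc.
apply/cvgrPdist_le => e e0.
have unear : \forall s \near t, forall i : 'I_m,
    `|u (successor x i) t - u (successor x i) s| <= e.
  apply: (@filter_forall R 'I_m (fun i s =>
    `|u (successor x i) t - u (successor x i) s| <= e) (nbhs t) _) => i.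
  by have /cvgrPdist_le := uc (successor x i) t; exact.
near=> s; apply: averaging_lipschitz => // k; rewrite !mxE.
by move: k; near: s.
Unshelve. all: by end_near. Qed.

Lemma picard_step_exists f u : (forall x, continuous (u x)) ->
  exists U, (forall x, continuous (U x)) /\ picard_step F f u U.
Proof.
move=> uc.
have /choice[G hG] x := halfline_primitive (Delta_continuous uc (x := x)).
have cU x : continuous (fun t => f x + G x t).
  by move=> t; apply: cvgD; [exact: cvg_cst|have [Gc _ _] := hG x; exact: Gc].
exists (fun x t => f x + G x t); split=> // x.
have [_ Gd G0] := hG x; split.
- exact: continuous_subspaceT.
- move=> t t0; rewrite -[Delta _ _ _ _]add0r.
  by apply: (@is_deriveD _ _ _ (cst (f x)) (G x)); exact: Gd.
- by rewrite G0 addr0.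
Qed.

(** The rate 4 of the weight is twice the Lipschitz constant 2 of [Delta], which
    is why integration gains a factor 1/2. *)
Lemma picard_step_contraction f u w U W (T K : R) : 0 <= K ->
  picard_step F f u U -> picard_step F f w W ->
  (forall x t, 0 <= t <= T -> `|u x t - w x t| <= K * expR (4 * t)) ->
  forall x t, 0 <= t <= T -> `|U x t - W x t| <= K / 2 * expR (4 * t).
Proof.
move=> K0 uU wW uw x t tT.
have [Uc Ud U0] := uU x; have [Wc Wd W0] := wW x.
apply: (@normr_le_expR_derive R (U x - W x)
         (Delta F u x - Delta F w x) K T) => //.
- have sub : `[0, T] `<=` (`[0, +oo[ : set R).
    by move=> s /=; rewrite !in_itv/= andbT => /andP[].
  move=> s; apply: (@continuousB _ _ (subspace `[0, T]) (U x) (W x)).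
    exact: (continuous_subspaceW sub Uc).
  exact: (continuous_subspaceW sub Wc).
- by rewrite !fctE U0 W0 subrr.
- by move=> s /andP[s0 _]; apply: is_deriveB; [exact: Ud|exact: Wd].
- move=> s /andP[s0 sT]; apply: Delta_lipschitz => y.
  by apply: uw; rewrite !ltW.
Qed.

(** Boundedness of the difference starts the induction, and each application of
    the contraction halves it in the weighted norm. *)
Lemma picard_fixed_point_unique f u w (T K : R) : 0 <= K ->
  picard_step F f u u -> picard_step F f w w ->
  (forall x t, 0 <= t <= T -> `|u x t - w x t| <= K) ->
  forall x t, 0 <= t <= T -> u x t = w x t.
Proof.
move=> K0 hu hw uw x t tT; apply/eqP; rewrite -subr_eq0 -normr_le0.
apply: (@le0_halvings R _ (K * expR (4 * t))) => n.
rewrite mulrAC; elim: n x t tT => [|n IHn] x t tT.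
  rewrite expr0 divr1; apply: (le_trans (uw x t tT)).
  by rewrite ler_peMr// -[leLHS]expR0 ler_expR mulr_ge0//; case/andP: tT.
rewrite exprSr invfM mulrA.
apply: (picard_step_contraction _ hu hw IHn) => //.
by rewrite divr_ge0// exprn_ge0.
Qed.

End Picard.

(** * Existence of a fixed point *)

Section PicardExistence.
Variables (R : realType) (m : nat) (F : 'rV[R]_m -> R).
Hypothesis hF : averaging_operator F.

(** Viewing the initial datum as the Picard image of 0 lets the contraction
    itself control the first increment of the iteration. *)
Lemma picard_step_zero (f : tree m -> R) :
  picard_step F f (fun _ _ => 0) (fun x _ => f x).
Proof.
move=> x; split=> //; first by apply: continuous_subspaceT; exact: cst_continuous.
move=> t _; rewrite /Delta subr0 (_ : \row__ _ = const_mx 0).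
  by rewrite (avg_zero hF); exact: is_derive_cst.
by apply/rowP => k; rewrite !mxE.
Qed.

Lemma picard_fixed_point_exists (f : tree m -> R) (M : R) :
  (forall x, `|f x| <= M) ->
  exists u, picard_step F f u u /\
    forall x t, 0 <= t -> `|u x t - f x| <= M * expR (4 * t).
Proof.
move=> fM; have M0 : 0 <= M by exact: le_trans (fM [::]).
have /choice[Phi hPhi] (u : tree m -> R -> R) :
    exists U, (forall x, continuous (u x)) ->
      (forall x, continuous (U x)) /\ picard_step F f u U.
  have [uc|nuc] := pselect (forall x, continuous (u x)); last by exists u.
  by have [U hU] := picard_step_exists hF f uc; exists U.
(* Outside continuous inputs, where the step may not exist, Phi is arbitrary. *)
pose v n : tree m -> R -> R := iter n Phi (fun x _ => f x).
have vc n : forall x, continuous (v n x).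
  elim: n => [|n IHn]; first by move=> x; exact: cst_continuous.
  by have [] := hPhi _ IHn.
have vS n : picard_step F f (v n) (v n.+1) by have [] := hPhi _ (vc n).
have vcontr (T : R) n : forall x t, 0 <= t <= T ->
    `|v n.+1 x t - v n x t| <= M / 2 / 2 ^+ n * expR (4 * t).
  elim: n => [|n IHn].
    rewrite expr0 divr1.
    apply: (picard_step_contraction hF M0 (vS 0%N) (W := v 0%N)).
      exact: picard_step_zero.
    move=> x t /andP[t0 _]; rewrite subr0 (le_trans (fM x))//.
    by rewrite ler_peMr// -[leLHS]expR0 ler_expR mulr_ge0.
  rewrite exprSr invfM mulrA.
  apply: (picard_step_contraction hF _ (vS n.+1) (vS n) IHn).
  by rewrite !divr_ge0// exprn_ge0.
have pos0 (t : R) : 0 <= Num.max t 0 by rewrite le_max lexx orbT.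
(* Times are clamped to [0, +oo[, the only place where the increments are
   controlled; the limit is then defined and continuous on the whole line. *)
have /choice[l hl] (p : tree m * R) : exists l, forall n,
    `|v n p.1 (Num.max p.2 0) - l| <= M * expR (4 * Num.max p.2 0) / 2 ^+ n.
  have [|l hl] := @halving_sequence_limit R (fun n => v n p.1 (Num.max p.2 0))
    (M / 2 * expR (4 * Num.max p.2 0)).
    by move=> n; rewrite mulrAC; apply: (vcontr (Num.max p.2 0)); rewrite pos0 lexx.
  by exists l => n; rewrite (le_trans (hl n))// mulrA mulrCA divff// mulr1.
pose u x t := l (x, t).
have vu n x t : 0 <= t -> `|v n x t - u x t| <= M * expR (4 * t) / 2 ^+ n.
  by move=> t0; have := hl (x, t) n; rewrite /= max_l.
have uc x : continuous (u x).
  apply: (@locally_uniform_halving_limit_continuous R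
    (fun n t => v n x (Num.max t 0)) _ (fun t => M * expR (4 * Num.max t 0))).
  - move=> s t st; rewrite ler_wpM2l// ler_expR ler_wpM2l//.
    by rewrite ge_max le_max st/= le_max lexx orbT.
  - move=> n t; apply: (@continuous_comp _ _ _ (fun t : R => Num.max t 0)).
      by apply: (@continuous_max R R id (cst 0)); [exact: cvg_id|exact: cvg_cst].
    exact: vc.
  - by move=> n t; exact: hl (x, t) n.
(* The limit u agrees with its Picard image U at nonnegative times only, so U,
   whose derivative is known, is the fixed point returned. *)
have [U [_ uU]] := picard_step_exists hF f uc.
have Uu x t : 0 <= t -> U x t = u x t.
  move=> t0; apply/eqP; rewrite -subr_eq0 -normr_le0.
  apply: (@le0_halvings R _ (M * expR (4 * t))) => n.
  have vU : `|v n.+1 x t - U x t| <= M / 2 ^+ n / 2 * expR (4 * t).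
    apply: (picard_step_contraction hF _ (vS n) uU (T := t)).
    - by rewrite divr_ge0// exprn_ge0.
    - by move=> y s /andP[s0 _]; rewrite mulrAC; exact: vu.
    - by rewrite t0 lexx.
  have := vu n.+1 x t t0; move: vU.
  rewrite exprSr [in X in _ -> X -> _]invfM [in X in _ -> X -> _]mulrA.
  rewrite [in X in X -> _]mulrAC [in X in X -> _](mulrAC M).
  by rewrite !ler_distl => /andP[? ?] /andP[? ?]; apply/andP; split; lra.
exists U; split=> [x|x t t0].
  have [Uxc Ud U0] := uU x; split=> // t t0; have := Ud t t0; congr is_derive.
  rewrite /Delta Uu ?ltW//; congr (F _ - _).
  by apply/rowP => k; rewrite !mxE Uu// ltW.
by rewrite Uu// distrC (le_trans (vu 0%N x t t0))// expr0 divr1.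
Qed.

End PicardExistence.

(** * Well-posedness of the Cauchy problem *)

Lemma Linfty_tree_bound (R : realType) (m : nat) (f : tree m -> R) :
  Linfty_tree f -> exists M, forall x, `|f x| <= M.
Proof.
move=> [M [_ fM]]; exists (M + 1) => x.
by apply: (fM (M + 1)) => //; rewrite ltrDl.
Qed.

Lemma Linfty_loc_bound (R : realType) (m : nat) (u : tree m -> R -> R) (T : R) :
  Linfty_loc u -> 0 < T ->
  exists M, forall x t, 0 <= t <= T -> `|u x t| <= M.
Proof.
move=> [_ ub] T0; have [M [_ uM]] := ub T T0.
exists (M + 1) => x t tT; apply: (uM (M + 1) _ (x, t)); first by rewrite ltrDl.
by split=> //=; rewrite in_itv.
Qed.

Theorem theorem1p1 (R : realType) (m : nat) (hm : (2 < m)%N)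
    (F : 'rV[R]_m -> R) (hF : averaging_operator F)
    (f : tree m -> R) (hf : Linfty_tree f) :
  exists u : tree m -> R -> R,
    (Linfty_loc u /\ cauchy_solution F f u) /\
    forall v : tree m -> R -> R, Linfty_loc v /\ cauchy_solution F f v ->
      forall (x : tree m) (t : R), 0 <= t -> v x t = u x t.
Proof.
have [M fM] := Linfty_tree_bound hf.
have M0 : 0 <= M by exact: le_trans (fM [::]).
have [u [uP uM]] := picard_fixed_point_exists hF fM.
have uloc : Linfty_loc u.
  split=> [x|T T0].
    have [uc _ _] := uP x.
    by apply: subspace_continuous_measurable_fun => //; exact: measurable_itv.
  exists (M + M * expR (4 * T)); split=> [|K ltK [x t] [_ /=]]; first exact: num_real.
  rewrite in_itv/= => /andP[t0 tT]; apply: le_trans (ltW ltK).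
  rewrite -(subrK (f x) (u x t)) addrC; apply: le_trans (ler_normD _ _) _.
  rewrite lerD// (le_trans (uM x t t0))// ler_wpM2l// ler_expR ler_wpM2l//.
exists u; split; first by split=> //; exact/cauchy_solution_picard.
move=> v [vloc /cauchy_solution_picard vP] x t t0.
have T0 : 0 < t + 1 by rewrite ltr_wpDl.
have [Ku uK] := Linfty_loc_bound uloc T0.
have [Kv vK] := Linfty_loc_bound vloc T0.
have t1 : 0 <= t <= t + 1 by rewrite t0 lerDl ler01.
have Kv0 : 0 <= Kv by exact: le_trans (vK x t t1).
have Ku0 : 0 <= Ku by exact: le_trans (uK x t t1).
apply: (picard_fixed_point_unique hF _ vP uP (K := Kv + Ku)) t1.
  by rewrite addr_ge0.
move=> y s sT; apply: le_trans (ler_normB _ _) _.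
by rewrite lerD ?vK ?uK.
Qed.
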